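(* There exists a nondegenerate $5$-dimensional simplex $S\subset Q_5=[0,1]^5$ such that the simplex $5S$ is circumscribed around $Q_5$ and the boundary of $5S$ contains all the vertices of the cube $Q_5$.
   Context: $Q_n=[0,1]^n\subset\mathbb{R}^n$. For a convex body $C\subset\mathbb{R}^n$ and $\sigma>0$, $\sigma C$ denotes the image of $C$ under the homothety with center at the center of gravity of $C$ and coefficient $\sigma$. For a simplex with vertices $x^{(1)},\dots,x^{(n+1)}$ the center of gravity is $\frac{1}{n+1}\sum_{j=1}^{n+1}x^{(j)}$. An $n$-dimensional simplex $T$ is said to be circumscribed around a convex body $C$ if $C\subset T$ and each $(n-1)$-dimensional face of $T$ contains a point of $C$. *)

(* Defs.v *)
From HB Require Import structures.
From mathcomp Require Import all_boot all_order all_algebra.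
From mathcomp Require Import all_classical all_reals all_analysis.
Import Order.TTheory GRing.Theory Num.Theory.
Import numFieldNormedType.Exports.
Set Implicit Arguments.
Unset Strict Implicit.
Unset Printing Implicit Defensive.
Local Open Scope classical_set_scope.
Local Open Scope ring_scope.

Definition cube (R : realType) (n : nat) : set 'rV[R]_n :=
  [set x | forall j, 0 <= x 0 j <= 1].

Definition cube_vertices (R : realType) (n : nat) : set 'rV[R]_n :=
  [set x | forall j, x 0 j = 0 \/ x 0 j = 1].

Definition conv_hull (R : realType) (n : nat) (A : set 'rV[R]_n) :
    set 'rV[R]_n :=
  smallest (@convex_set R 'rV[R]_n) A.

Definition affinely_independent (R : realType) (n : nat)
    (v : 'I_n.+1 -> 'rV[R]_n) : Prop :=
  row_free (\matrix_(i < n) (v (lift ord0 i) - v ord0)).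

Definition simplex (R : realType) (n : nat) (v : 'I_n.+1 -> 'rV[R]_n) :
    set 'rV[R]_n :=
  conv_hull (range v).

(* The (n-1)-dimensional face opposite to the vertex v i. *)
Definition facet (R : realType) (n : nat) (v : 'I_n.+1 -> 'rV[R]_n)
    (i : 'I_n.+1) : set 'rV[R]_n :=
  conv_hull (v @` [set j | j != i]).

Definition centroid (R : realType) (n : nat) (v : 'I_n.+1 -> 'rV[R]_n) :
    'rV[R]_n :=
  n.+1%:R^-1 *: \sum_(j < n.+1) v j.

Definition homothety (R : realType) (n : nat) (c : 'rV[R]_n) (s : R)
    (x : 'rV[R]_n) : 'rV[R]_n :=
  c + s *: (x - c).

Definition dilated_simplex (R : realType) (n : nat) (s : R)
    (v : 'I_n.+1 -> 'rV[R]_n) : set 'rV[R]_n :=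
  homothety (centroid v) s @` simplex v.

(* The vertices of a nondegenerate simplex are determined by the simplex up to
   order, so the choice of w is immaterial. *)
Definition circumscribed (R : realType) (n : nat) (T C : set 'rV[R]_n) : Prop :=
  exists w : 'I_n.+1 -> 'rV[R]_n,
    [/\ affinely_independent w, T = simplex w, C `<=` T &
        forall i, facet w i `&` C !=set0].

Definition boundary (T : topologicalType) (A : set T) : set T :=
  closure A `\` interior A.

(* Main.v *)
Require Import Defs.
From HB Require Import structures.
From mathcomp Require Import all_boot all_order all_algebra.
From mathcomp Require Import all_classical all_reals all_analysis.
From mathcomp Require Import ring lra.
Import Order.TTheory GRing.Theory Num.Theory.
Import numFieldNormedType.Exports.
Set Implicit Arguments.
Unset Strict Implicit.
Unset Printing Implicit Defensive.
Local Open Scope classical_set_scope.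
Local Open Scope ring_scope.

(**
   A simplex with vertices v_0, ..., v_n is best described by its barycentric
   coordinates, the affine functions b_i with b_i (v_j) = 1 if i = j and 0
   otherwise. The simplex is the set where all b_i are nonnegative
   ([simplexP]), and at the centroid every b_i is 1/(n+1). Dilating by s about
   the centroid stretches each b_i - 1/(n+1) by a factor s, so the dilated
   simplex is cut out by b_i >= (1 - s)/(n+1), and its facets lie where one of
   these inequalities is an equality. For n = s = 5 the threshold is -2/3.

   The statement thus asks for six affine functions b_i on the cube, dual to
   points v_i of the cube, such that every b_i has minimum exactly -2/3 on the
   cube and every vertex of the cube minimizes at least one b_i. Centring the
   simplex at the centre of the cube gives each b_i the value 1/6 there, so the
   absolute values of the coefficients of each b_i must sum to 5/3. The
   vertices of the cube that minimize b_i form the subcube on which the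
   coordinates used by b_i are prescribed, so six subcubes have to cover the 32
   vertices. They are taken to be the leaves of a decision tree: the root tests
   x_0; if x_0 = 0, then x_1 is tested, and also x_2 if x_1 = 1; if x_0 = 1,
   then x_3 is tested, and also x_4 if x_3 = 1. As barycentric coordinates sum
   to 1, the six coefficients of each x_k must moreover sum to zero. A solution
   that treats both branches of the tree alike is

     b_0 =   2/3 x_0 + x_1 - 2/3,
     b_1 =   1/6 x_0 - 1/2 x_1 + x_2 - 1/6,
     b_2 =   1/6 x_0 - 1/2 x_1 - x_2 + 5/6,
     b_3 = - 2/3 x_0 + x_3,
     b_4 = - 1/6 x_0 - 1/2 x_3 + x_4,
     b_5 = - 1/6 x_0 - 1/2 x_3 - x_4 + 1,

   whose dual points do lie in the cube. It remains to evaluate these functions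
   ([baryE]) and to carry the inequalities over to the geometric notions
   ([circumscribed_dilated], [dilated_boundary]).
*)

(** * Convex sets and convex combinations *)

(** Replaces the weights bundled with a proof of lying in [0, 1] by plain
    reals. *)
Lemma convex_setP (R : realType) (n : nat) (A : set 'rV[R]_n) :
  @convex_set R 'rV[R]_n A <->
  forall x y (t : R), 0 <= t <= 1 -> A x -> A y -> A (t *: x + (1 - t) *: y).
Proof.
split=> [cA x y t /andP[t0 t1] Ax Ay|cA x y t /set_mem Ax /set_mem Ay].
  have : x \in A by rewrite inE.
  have : y \in A by rewrite inE.
  move=> yA xA; have := cA x y (Itv01 t0 t1) xA yA.
  by rewrite inE.
by apply/mem_set; apply: cA => //; rewrite ge0 le1.
Qed.

(** Only points of positive weight have to lie in [A]; this is what lets a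
    facet be treated on the same footing as the whole simplex. *)
Lemma convex_sum (R : realType) (n : nat) (A : set 'rV[R]_n) (I : finType)
    (mu : I -> R) (v : I -> 'rV[R]_n) :
  @convex_set R 'rV[R]_n A ->
  (forall i, 0 <= mu i) -> \sum_i mu i = 1 -> (forall i, 0 < mu i -> A (v i)) ->
  A (\sum_i mu i *: v i).
Proof.
move=> /convex_setP cA mu0 mu1 vA.
(* Induction needs the renormalized mean of the first terms, which only makes
   sense once some weight is positive. *)
have partial (s : seq I) : 0 < \sum_(i <- s) mu i ->
    A ((\sum_(i <- s) mu i)^-1 *: \sum_(i <- s) mu i *: v i).
  elim: s => [|i s IHs]; first by rewrite big_nil ltxx.
  rewrite !big_cons; set m := \sum_(j <- s) mu j; set y := \sum_(j <- s) _.
  move=> pos.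
  have m0 : 0 <= m by apply: sumr_ge0.
  have [mi0|mi0] := eqVneq (mu i) 0.
    by move: pos; rewrite mi0 scale0r !add0r; exact: IHs.
  have mi : 0 < mu i by rewrite lt_neqAle eq_sym mi0 mu0.
  have [mE|mN] := eqVneq m 0.
    have -> : y = 0.
      apply: big1_seq => j /andP[_ js].
      have /eqP := mE; rewrite psumr_eq0// => /allP/(_ _ js)/eqP ->.
      by rewrite scale0r.
    by rewrite mE !addr0 scalerA mulVf// scale1r; exact: vA.
  have mp : 0 < m by rewrite lt_neqAle eq_sym mN.
  have -> : (mu i + m)^-1 *: (mu i *: v i + y) =
      (mu i / (mu i + m)) *: v i + (1 - mu i / (mu i + m)) *: (m^-1 *: y).
    rewrite scalerDr !scalerA mulrC; congr (_ + _ *: _).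
    have -> : 1 - mu i / (mu i + m) = m / (mu i + m).
      by rewrite -{1}(divff (lt0r_neq0 pos)) -mulrBl addrC addKr.
    by rewrite mulrAC divff// mul1r.
  apply: cA; [|exact: vA|exact: IHs].
  by rewrite divr_ge0 ?(ltW mi) ?(ltW pos)//= ler_pdivrMr// mul1r lerDl.
have := partial (index_enum I); rewrite mu1 invr1 scale1r; apply.
exact: ltr01.
Qed.

(** * Barycentric coordinates of a simplex *)

Definition bary (R : realType) (n : nat) (G : 'M[R]_(n, n.+1)) (c : 'rV[R]_n.+1)
    (x : 'rV[R]_n) : 'rV[R]_n.+1 := x *m G + c.

Definition barycentric (R : realType) (n : nat) (v : 'I_n.+1 -> 'rV[R]_n)
    (G : 'M[R]_(n, n.+1)) (c : 'rV[R]_n.+1) : Prop :=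
  forall j, bary G c (v j) = delta_mx 0 j.

Lemma bary_affine (R : realType) (n : nat) (G : 'M[R]_(n, n.+1))
    (c : 'rV[R]_n.+1) (x y : 'rV[R]_n) (t : R) i :
  bary G c (x + t *: (y - x)) 0 i =
  bary G c x 0 i + t * (bary G c y 0 i - bary G c x 0 i).
Proof.
rewrite /bary mulmxDl -scalemxAl mulmxBl !mxE opprD addrACA subrr addr0.
by rewrite -!addrA; congr (_ + _); rewrite addrC.
Qed.

Section Barycentric.
Variables (R : realType) (n : nat) (v : 'I_n.+1 -> 'rV[R]_n).
Variables (G : 'M[R]_(n, n.+1)) (c : 'rV[R]_n.+1).
Hypothesis vG : barycentric v G c.

(** The gradients of the last [n] coordinates form an inverse of the matrix of
    edges issued from the first vertex. *)
Lemma barycentric_affinely_independent : affinely_independent v.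
Proof.
apply/row_freeP; exists (colsub (lift ord0) G).
apply/matrixP=> i k.
have : bary G c (v (lift ord0 i)) - bary G c (v ord0) =
    delta_mx 0 (lift ord0 i) - delta_mx 0 ord0 by rewrite !vG.
move=> /rowP/(_ (lift ord0 k)).
rewrite /bary opprD addrACA subrr addr0 -mulmxBl !mxE /=.
rewrite (inj_eq lift_inj) /= subr0 eq_sym => <-.
by apply: eq_bigr => l _; rewrite !mxE.
Qed.

Let V : 'M[R]_(n.+1, n) := \matrix_j v j.

(* Homogeneous coordinates: the defining equations say that the matrix of the
   vertices, with a column of ones added, has the matrix of the affine
   functions as right inverse. Being square, the latter is also a left
   inverse, and its blocks give the two lemmas that follow. *)
Let homogeneous_inverse :
  (col_mx c G : 'M[R]_(1 + n, n.+1)) *m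
  (row_mx (const_mx 1) V : 'M[R]_(n.+1, 1 + n)) = 1%:M.
Proof.
apply: mulmx1C; rewrite mul_row_col.
apply/row_matrixP=> j; have := vG j; rewrite /bary => vj.
rewrite row1 -vj linearD /= !row_mul addrC /V rowK; congr (_ + _).
by apply/rowP=> k; rewrite !mxE big_ord1 !mxE mul1r.
Qed.

Lemma bary_sum (x : 'rV[R]_n) : \sum_j bary G c x 0 j = 1.
Proof.
have := homogeneous_inverse; rewrite mul_col_row (scalar_mx_block 1 n 1).
move=> /eq_block_mx [c1 _ G1 _].
have : bary G c x *m const_mx 1 = 1%:M :> 'M[R]_1.
  by rewrite /bary mulmxDl -mulmxA G1 mulmx0 add0r.
move=> /matrixP/(_ 0 0); rewrite [RHS]mxE mulr1n => <-; rewrite mxE.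
by apply: eq_bigr => j _; rewrite [const_mx _ _ _]mxE mulr1.
Qed.

Lemma bary_recombine (x : 'rV[R]_n) : \sum_j bary G c x 0 j *: v j = x.
Proof.
have := homogeneous_inverse; rewrite mul_col_row (scalar_mx_block 1 n 1).
move=> /eq_block_mx [_ cV _ GV].
transitivity (bary G c x *m V); last first.
  by rewrite /bary mulmxDl -mulmxA GV cV addr0 mulmx1.
by rewrite mulmx_sum_row; apply: eq_bigr => j _; rewrite rowK.
Qed.

Lemma simplexP (x : 'rV[R]_n) :
  simplex v x <-> forall i, 0 <= bary G c x 0 i.
Proof.
split=> [|x0].
  apply: (@smallest_sub _ _ _ [set y | forall i, 0 <= bary G c y 0 i]).
    apply/convex_setP => y z t /andP[t0 t1] /= y0 z0 i.
    have -> : t *: y + (1 - t) *: z = z + t *: (y - z).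
      by rewrite scalerBl scalerBr scale1r addrCA.
    rewrite bary_affine mulrBr addrCA -[X in _ + (X - _)]mul1r -mulrBl.
    by rewrite addr_ge0// mulr_ge0// subr_ge0.
  by move=> _ [j _ <-] i /=; rewrite vG mxE ler0n.
rewrite -(bary_recombine x) => A [cA vA].
by apply: convex_sum => // [|i _]; [exact: bary_sum|apply: vA; exists i].
Qed.

Lemma facet_sub (x : 'rV[R]_n) (i : 'I_n.+1) :
  (forall j, 0 <= bary G c x 0 j) -> bary G c x 0 i = 0 -> facet v i x.
Proof.
move=> x0 xi; rewrite -(bary_recombine x) => A [cA vA].
apply: convex_sum => // [|j xj]; first exact: bary_sum.
by apply: vA; exists j => //=; apply: contraTneq xj => ->; rewrite xi ltxx.
Qed.

(** A point where coordinate [i] vanishes leaves the simplex as soon as it moves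
    away from vertex [i], because that coordinate becomes negative. *)
Lemma simplex_boundary (x : 'rV[R]_n) (i : 'I_n.+1) :
  (forall j, 0 <= bary G c x 0 j) -> bary G c x 0 i = 0 ->
  boundary (simplex v) x.
Proof.
move=> x0 xi; split; first exact/subset_closure/simplexP.
rewrite /interior /= => nx.
have cont : (fun t : R => x + t *: (v i - x)) @ (0 : R) --> x.
  rewrite -[X in _ --> X]addr0 -(scale0r (v i - x)).
  by apply: cvgD; [exact: cvg_cst|apply: cvgZr_tmp; exact: cvg_id].
have /(_ _ nx) := cont.
move=> /nbhs_ballP[e /= e0 /(_ (- (e / 2)))].
(* The step is negative: x - (e / 2) (v_i - x) points away from v_i. *)
rewrite -ball_normE /= sub0r opprK ger0_norm; last by rewrite divr_ge0// ltW.
rewrite ltr_pdivrMr// ltr_pMr// ltr1n => /(_ isT) /simplexP/(_ i).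
rewrite bary_affine vG xi mxE 2!eqxx /=.
by rewrite add0r subr0 mulr1 oppr_ge0 leNgt divr_gt0.
Qed.

(** * Dilation about the centroid *)

Lemma bary_centroid : bary G c (centroid v) = const_mx n.+1%:R^-1.
Proof.
apply/rowP=> k; have n0 : n.+1%:R != 0 :> R by rewrite pnatr_eq0.
have -> : bary G c (centroid v) = n.+1%:R^-1 *: \sum_j bary G c (v j).
  rewrite /bary /centroid -scalemxAl mulmx_suml big_split /= sumr_const card_ord.
  by rewrite -[c *+ _]scaler_nat scalerDr scalerA mulVf// scale1r.
rewrite (eq_bigr _ (fun j _ => vG j)) !mxE summxE (bigD1 k)//= mxE !eqxx.
by rewrite big1 ?addr0 ?mulr1// => j jk; rewrite mxE /= eq_sym (negPf jk).
Qed.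

(** The value taken by barycentric coordinate [i] of the original simplex on
    facet [i] of the dilated one. *)
Definition dilation_level (s : R) : R := (1 - s) / n.+1%:R.

Definition dilated_vertices (s : R) : 'I_n.+1 -> 'rV[R]_n :=
  homothety (centroid v) s \o v.

Definition dilated_gradient (s : R) : 'M[R]_(n, n.+1) := s^-1 *: G.

Definition dilated_constant (s : R) : 'rV[R]_n.+1 :=
  s^-1 *: (c - const_mx (dilation_level s)).

Lemma dilated_baryE (s : R) (x : 'rV[R]_n) i :
  bary (dilated_gradient s) (dilated_constant s) x 0 i =
  s^-1 * (bary G c x 0 i - dilation_level s).
Proof.
rewrite /bary /dilated_gradient /dilated_constant -scalemxAr -scalerDr addrA.
by rewrite !mxE.
Qed.

(** Barycentric coordinates are affine invariants, so those of the image of a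
    point in the dilated simplex are those of the point in the original. *)
Lemma dilated_bary_homothety (s : R) (x : 'rV[R]_n) : s != 0 ->
  bary (dilated_gradient s) (dilated_constant s)
    (homothety (centroid v) s x) = bary G c x.
Proof.
move=> s0; apply/rowP=> i; rewrite dilated_baryE /homothety bary_affine.
rewrite bary_centroid [const_mx _ _ _]mxE /dilation_level.
have : n.+1%:R != 0 :> R by rewrite pnatr_eq0.
by move: n.+1%:R => N N0; field; rewrite N0.
Qed.

Lemma barycentric_dilated (s : R) : s != 0 ->
  barycentric (dilated_vertices s) (dilated_gradient s) (dilated_constant s).
Proof. by move=> s0 j; rewrite /dilated_vertices /= dilated_bary_homothety. Qed.

End Barycentric.

Section Dilation.
Variables (R : realType) (n : nat) (v : 'I_n.+1 -> 'rV[R]_n).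
Variables (G : 'M[R]_(n, n.+1)) (c : 'rV[R]_n.+1) (s : R).
Hypotheses (vG : barycentric v G c) (s_gt0 : 0 < s).

Let vG' := barycentric_dilated vG (lt0r_neq0 s_gt0).

Lemma dilated_simplexE : dilated_simplex s v = simplex (dilated_vertices v s).
Proof.
have s0 := lt0r_neq0 s_gt0.
apply/seteqP; split=> [_ [x /(simplexP vG) x0 <-]|y /(simplexP vG') y0].
  by apply/(simplexP vG') => i; rewrite (dilated_bary_homothety vG).
have yE : homothety (centroid v) s (homothety (centroid v) s^-1 y) = y.
  by rewrite /homothety addrAC subrr add0r scalerA divff// scale1r addrC subrK.
exists (homothety (centroid v) s^-1 y) => //; apply/(simplexP vG) => i.
by rewrite -(dilated_bary_homothety vG _ s0) yE.
Qed.

Let dilated_bary_ge0 (x : 'rV[R]_n) :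
  (forall i, dilation_level n s <= bary G c x 0 i) ->
  forall i,
    0 <= bary (dilated_gradient G s) (dilated_constant c s) x 0 i.
Proof.
by move=> x0 i; rewrite dilated_baryE mulr_ge0 ?subr_ge0// invr_ge0 ltW.
Qed.

Let dilated_bary_eq0 (x : 'rV[R]_n) i :
  bary G c x 0 i = dilation_level n s ->
  bary (dilated_gradient G s) (dilated_constant c s) x 0 i = 0.
Proof. by move=> xi; rewrite dilated_baryE xi subrr mulr0. Qed.

Lemma circumscribed_dilated (C : set 'rV[R]_n) :
  (forall x, C x -> forall i, dilation_level n s <= bary G c x 0 i) ->
  (forall i, exists2 x, C x & bary G c x 0 i = dilation_level n s) ->
  circumscribed (dilated_simplex s v) C.
Proof.
move=> CT Ctouch; exists (dilated_vertices v s); split.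
- exact: barycentric_affinely_independent vG'.
- exact: dilated_simplexE.
- move=> x Cx; rewrite dilated_simplexE.
  by apply/(simplexP vG') => i; apply: dilated_bary_ge0; exact: CT.
- move=> i; have [x Cx xi] := Ctouch i; exists x; split=> //.
  apply: (facet_sub vG'); first by move=> j; apply: dilated_bary_ge0; exact: CT.
  exact: dilated_bary_eq0.
Qed.

Lemma dilated_boundary (x : 'rV[R]_n) i :
  (forall j, dilation_level n s <= bary G c x 0 j) ->
  bary G c x 0 i = dilation_level n s ->
  boundary (dilated_simplex s v) x.
Proof.
move=> x0 xi; rewrite dilated_simplexE; apply: (simplex_boundary vG' (i := i)).
  exact: dilated_bary_ge0.
exact: dilated_bary_eq0.
Qed.

End Dilation.

(** * The simplex in the five-dimensional cube *)

Definition vec (R : realType) (n : nat) (s : seq R) : 'rV[R]_n :=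
  \row_j s`_j.

Definition vertex (R : realType) (i : 'I_6) : 'rV[R]_5 :=
  vec 5 (nth [::]
    [:: [:: 1; 1;     2^-1; 2 / 3; 2^-1];
        [:: 1; 0;     1;    2 / 3; 2^-1];
        [:: 1; 0;     0;    2 / 3; 2^-1];
        [:: 0; 2 / 3; 2^-1; 1;     2^-1];
        [:: 0; 2 / 3; 2^-1; 0;     1];
        [:: 0; 2 / 3; 2^-1; 0;     0]] i).

(** The rows listed are the gradients of the six barycentric coordinates, which
    become the columns of the matrix. *)
Definition gradient (R : realType) : 'M[R]_(5, 6) :=
  \matrix_(j, i) (vec 5 (nth [::]
    [:: [:: 2 / 3;     1;       0;   0;       0];
        [:: 6^-1;      - 2^-1;  1;   0;       0];
        [:: 6^-1;      - 2^-1;  - 1; 0;       0];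
        [:: - (2 / 3); 0;       0;   1;       0];
        [:: - 6^-1;    0;       0;   - 2^-1;  1];
        [:: - 6^-1;    0;       0;   - 2^-1;  - 1]] i)) 0 j.

Definition constant (R : realType) : 'rV[R]_6 :=
  vec 6 [:: - (2 / 3); - 6^-1; 5 / 6; 0; 0; 1].

Lemma ord6P (P : 'I_6 -> Prop) :
  P 0 -> P 1 -> P 2 -> P 3 -> P 4 -> P 5 -> forall i, P i.
Proof.
move=> p0 p1 p2 p3 p4 p5 [[|[|[|[|[|[|//]]]]]] i6].
- by have -> : Ordinal i6 = 0 by apply/val_inj.
- by have -> : Ordinal i6 = 1 by apply/val_inj.
- by have -> : Ordinal i6 = 2 by apply/val_inj.
- by have -> : Ordinal i6 = 3 by apply/val_inj.
- by have -> : Ordinal i6 = 4 by apply/val_inj.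
- by have -> : Ordinal i6 = 5 by apply/val_inj.
Qed.

Lemma baryE (R : realType) (x : 'rV[R]_5) :
  let b := bary (gradient R) (constant R) x 0 in
  [/\ b 0 = 2 / 3 * x 0 0 + x 0 1 - 2 / 3,
      b 1 = 6^-1 * x 0 0 - 2^-1 * x 0 1 + x 0 2 - 6^-1 &
      b 2 = 6^-1 * x 0 0 - 2^-1 * x 0 1 - x 0 2 + 5 / 6] /\
  [/\ b 3 = - (2 / 3) * x 0 0 + x 0 3,
      b 4 = - 6^-1 * x 0 0 - 2^-1 * x 0 3 + x 0 4 &
      b 5 = - 6^-1 * x 0 0 - 2^-1 * x 0 3 - x 0 4 + 1].
Proof.
have sum5 (F : 'I_5 -> R) : \sum_j F j = F 0 + F 1 + F 2 + F 3 + F 4.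
  rewrite !big_ord_recr big_ord0 /= add0r.
  by congr (F _ + F _ + F _ + F _ + F _); apply/val_inj.
move=> b; rewrite /b /bary.
by split; split; rewrite 2!mxE sum5 !mxE /=; ring.
Qed.

Theorem theorem4 (R : realType) :
  exists v : 'I_6 -> 'rV[R]_5,
    [/\ affinely_independent v,
        simplex v `<=` @cube R 5,
        circumscribed (dilated_simplex 5 v) (@cube R 5) &
        @cube_vertices R 5 `<=` boundary (dilated_simplex 5 v)].
Proof.
have level : dilation_level 5 (5 : R) = - (2 / 3) by rewrite /dilation_level; lra.
have bar : barycentric (@vertex R) (gradient R) (constant R).
  apply: ord6P; set w := vertex _ _; apply/rowP;
    have [[h0 h1 h2] [h3 h4 h5]] := baryE w; apply: ord6P;
    rewrite ?h0 ?h1 ?h2 ?h3 ?h4 ?h5 !mxE /=; lra.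
have cubeT (x : 'rV[R]_5) : cube x ->
    forall i, dilation_level 5 5 <= bary (gradient R) (constant R) x 0 i.
  move=> xQ; rewrite level; have [[h0 h1 h2] [h3 h4 h5]] := baryE x.
  have /andP[? ?] := xQ 0; have /andP[? ?] := xQ 1; have /andP[? ?] := xQ 2.
  have /andP[? ?] := xQ 3; have /andP[? ?] := xQ 4.
  by apply: ord6P; rewrite ?h0 ?h1 ?h2 ?h3 ?h4 ?h5; lra.
exists (@vertex R); split.
- exact: barycentric_affinely_independent bar.
- apply: smallest_sub.
    apply/convex_setP => x y t /andP[t0 t1] xQ yQ j; rewrite 3!mxE.
    have /andP[? ?] := xQ j; have /andP[? ?] := yQ j.
    by apply/andP; split; nra.
  move=> _ [i _ <-] [j j5]; rewrite mxE /=.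
  move: i; apply: ord6P; case: j j5 => [|[|[|[|[|//]]]]] _ /=; lra.
- apply: (circumscribed_dilated bar) => //.
  (* The coordinates used by the i-th function are chosen so as to minimize it,
     the others are 0. *)
  pose w (i : 'I_6) := vec 5 (nth [::]
    [:: [:: 0; 0; 0; 0; 0]; [:: 0; 1; 0; 0; 0]; [:: 0; 1; 1; 0; 0];
        [:: 1; 0; 0; 0; 0]; [:: 1; 0; 0; 1; 0]; [:: 1; 0; 0; 1; 1]] i) : 'rV[R]_5.
  move=> i; exists (w i).
    move=> [j j5]; rewrite mxE /=.
    move: i; apply: ord6P; case: j j5 => [|[|[|[|[|//]]]]] _ /=; lra.
  move: i; rewrite level; apply: ord6P; set y := w _;
    have [[h0 h1 h2] [h3 h4 h5]] := baryE y;
    rewrite ?h0 ?h1 ?h2 ?h3 ?h4 ?h5 !mxE /=; lra.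
- move=> x xV.
  have xQ : cube x by move=> j; case: (xV j) => ->; lra.
  have [[h0 h1 h2] [h3 h4 h5]] := baryE x.
  suff [i xi] : exists i,
      bary (gradient R) (constant R) x 0 i = dilation_level 5 5.
    by apply: (dilated_boundary bar _ _ xi) => //; exact: cubeT.
  rewrite level.
  (* Walking down the decision tree finds the function that x minimizes. *)
  case: (xV 0) => x0.
    case: (xV 1) => x1; first by exists 0; lra.
    by case: (xV 2) => x2; [exists 1|exists 2]; lra.
  case: (xV 3) => x3; first by exists 3; lra.
  by case: (xV 4) => x4; [exists 4|exists 5]; lra.
Qed.
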